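(* Let $S$ be an orientable, manifold-like combinatorial cell complex (c.c.c.) of dimension $n$. Assume that each cell of $S$ and each cell of the dual c.c.c. $S^{\circ}$ is flag-connected and acyclic. Then $H_i(S)\simeq H^{n-i}(S)$ for all $i$.
   Context: C.c.c. A combinatorial cell complex (c.c.c.) is a finite poset $(S,\le)$ with a rank function $\mathrm{rk}\colon S\to\mathbb{Z}_{\ge 0}$; elements are called cells, $S(r)$ is the set of cells of rank $r$ ($r$-cells; $0$-cells are vertices). A face of $x$ is a cell $y<x$ with $\mathrm{rk}(y)=\mathrm{rk}(x)-1$; then $x$ is a co-face of $y$. $\Delta x$ (resp. $\nabla x$) is the set of faces (resp. co-faces) of $x$. $\wedge$, $\vee$ denote greatest lower bound and least upper bound (considered for nonempty subsets only). Axioms: (1) $y<x$ implies $\mathrm{rk}(y)<\mathrm{rk}(x)$. (2) Every nonempty subset $T\subseteq S$ that is bounded below has a greatest lower bound $\wedge T$; and if $y<x$ there is a cell $y'$ with $\mathrm{rk}(y')=\mathrm{rk}(y)+1$ and $y<y'\le x$. (3) Each cell $x$ of rank at least one is the least upper bound of its faces, $x=\vee\Delta x$ (in particular $\Delta x\ne\emptyset$). (4) If $y<x$ and $\mathrm{rk}(x)=\mathrm{rk}(y)+2$ then $\Delta x\cap\nabla y$ consists of exactly two cells $y_+\neq y_-$, and $y_+\wedge y_-=y$. Write $\mathrm{cl}(x)=\{y\in S: y\le x\}$. A down-closed subset of $S$ is called closed; with the induced order and rank it is a c.c.c. Manifold-like. The dimension of $S$ is the maximal rank of a cell. $S$ is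 equidimensional of dimension $n$ if every maximal cell has rank $n$. For such $S$, the boundary of $S$ is the set of cells of rank $<n$ having only one maximal cell above them. $S$ is non-singular if it is equidimensional (of dimension $n$), each $(n-1)$-cell is a face of at most two maximal cells, and each $1$-cell has exactly two vertices. $S$ is manifold-like if it is non-singular with empty boundary. Dual. For manifold-like $S$ of dimension $n$, $S^{\circ}=\{x^{\circ}:x\in S\}$ with $x^\circ\le y^\circ$ iff $x\ge y$ and $\mathrm{rk}(x^\circ)=n-\mathrm{rk}(x)$; this is a manifold-like c.c.c. of dimension $n$. Orientation. A flag in an equidimensional c.c.c. $S$ of dimension $n$ is a chain $x_0<x_1<\dots<x_n$ with $x_i\in S(i)$; $\mathcal{F}(S)$ is the set of flags. Two flags are adjacent if they differ in exactly one element; $\mathcal{F}(S)$ is also regarded as the graph with these adjacencies. $S$ is flag-connected if this graph is connected, and orientable if it is connected and bipartite. An orientation is a function $\omega\colon\mathcal{F}(S)\to\{\pm1\}$ taking opposite values on adjacent flags. A cell $x$ is flag-connected/orientable if $\mathrm{cl}(x)$ is; an orientation on $x$ means one on $\mathrm{cl}(x)$; $\mathcal F(x)=\mathcal F(\mathrm{cl}(x))$. If $S$ is orientable with flag-connected cells then every cell of $S$ is orientable, so the homology below is defined (likewise for $S^\circ$). Homology. Let $S$ be a c.c.c. all of whose cells are orientable. Choose an orientation $\omega_x$ on each cell $x$ (with $\omega_v(\{v\})=1$ for vertices $v$). For $y\in\Delta x$ put $s(x,y)=\omega_x(\gamma)/\omega_y(\gamma\setminus\{x\})\in\{\pm1\}$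 for any flag $\gamma=\{x>y>\cdots\}\in\mathcal{F}(x)$ (independent of $\gamma$). $C_i(S)$ is the free abelian group on symbols $[x]$, $x\in S(i)$; $\partial[x]=\sum_{y\in\Delta x}s(x,y)[y]$ and $\delta[x]=\sum_{z\in\nabla x}s(z,x)[z]$. $H_i(S)$ is the homology of $(C_\bullet(S),\partial)$ in degree $i$ and $H^i(S)$ the cohomology of $(C_\bullet(S),\delta)$ in degree $i$; up to isomorphism they do not depend on the chosen orientations. $S$ is acyclic if $H_i(S)=0$ for $i>0$ and $H_0(S)\simeq\mathbb{Z}$; a cell $x$ is acyclic if $\mathrm{cl}(x)$ is. *)

(* Defs.v *)
From HB Require Import structures.
From mathcomp Require Import all_boot all_order all_algebra.
From mathcomp Require Import ring_quotient.
From mathcomp Require boolp.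

Set Implicit Arguments.
Unset Strict Implicit.
Unset Printing Implicit Defensive.

Import Order.TTheory GRing.Theory.
Local Open Scope ring_scope.

(* A ranked finite poset is a [finPOrderType] [T] with a function [rk : T -> nat];
   its closed subcomplexes, such as [cl x], are represented by subsets
   [A : {set T}], with the induced order and rank, and the whole complex is
   [[set: T]].  The underlying poset of the dual complex is the order dual
   [T^d]. *)

Section RankedPoset.
Context {d : Order.disp_t} {T : finPOrderType d}.
Variable rk : T -> nat.
Implicit Types (x y z : T) (A B : {set T}).

Definition faces x : {set T} := [set y | (y < x)%O & (rk y).+1 == rk x].
Definition cofaces y : {set T} := [set x | y \in faces x].
Definition cl x : {set T} := [set y | (y <= x)%O].

Definition is_glb B m : Prop :=
  (forall y, y \in B -> (m <= y)%O) /\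
  (forall l, (forall y, y \in B -> (l <= y)%O) -> (l <= m)%O).

Definition is_lub B m : Prop :=
  (forall y, y \in B -> (y <= m)%O) /\
  (forall u, (forall y, y \in B -> (y <= u)%O) -> (m <= u)%O).

Record is_ccc : Prop := IsCcc {
  ccc_rk_lt : forall x y, (y < x)%O -> (rk y < rk x)%N;
  ccc_glb : forall B, B != set0 ->
    (exists l, forall y, y \in B -> (l <= y)%O) -> exists m, is_glb B m;
  ccc_step : forall x y, (y < x)%O ->
    exists y', [/\ rk y' = (rk y).+1, (y < y')%O & (y' <= x)%O];
  (* least upper bounds are only considered for nonempty sets *)
  ccc_lub_faces : forall x, (0 < rk x)%N ->
    faces x != set0 /\ is_lub (faces x) x;
  ccc_diamond : forall x y, (y < x)%O -> rk x = (rk y).+2 ->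
    exists yp ym, [/\ yp != ym, faces x :&: cofaces y = [set yp; ym]
                    & is_glb [set yp; ym] y]
}.

Definition ccdim A : nat := \max_(x in A) rk x.

Definition maximal_in A x : bool :=
  (x \in A) && [forall y in A, ~~ (x < y)%O].

Definition maximal_above A x : {set T} :=
  [set m | maximal_in A m & (x <= m)%O].

Definition equidimensional A : Prop :=
  forall x, maximal_in A x -> rk x = ccdim A.

Definition boundary A : {set T} :=
  [set x in A | (rk x < ccdim A)%N & #|maximal_above A x| == 1%N].

Definition non_singular A : Prop :=
  [/\ equidimensional A,
      forall x, x \in A -> (rk x).+1 = ccdim A ->
        (#|[set m | maximal_in A m & x \in faces m]| <= 2)%N
    & forall x, x \in A -> rk x = 1%N ->
        #|[set v in A | rk v == 0%N & (v <= x)%O]| = 2%N].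

Definition manifold_like A : Prop := non_singular A /\ boundary A = set0.

(* A flag is identified with the set of its members. *)
Definition is_flag A (F : {set T}) : bool :=
  [exists f : {ffun 'I_(ccdim A).+1 -> T},
    [&& [forall i : 'I_(ccdim A).+1, (f i \in A) && (rk (f i) == i)],
        [forall i : 'I_(ccdim A).+1, forall j : 'I_(ccdim A).+1,
           (i < j)%N ==> (f i < f j)%O]
      & F == [set f i | i : 'I_(ccdim A).+1]]].

Definition flags A : {set {set T}} := [set F | is_flag A F].

Definition flag_adj A : rel {set T} := fun F G =>
  [&& F \in flags A, G \in flags A, #|F :\: G| == 1%N & #|G :\: F| == 1%N].

Definition flag_connected A : Prop :=
  forall F G, F \in flags A -> G \in flags A -> connect (flag_adj A) F G.

Definition flag_bipartite A : Prop :=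
  exists c : {set T} -> bool, forall F G, flag_adj A F G -> c F != c G.

Definition orientable A : Prop := flag_connected A /\ flag_bipartite A.

(* Only the values of [om] on [flags A] matter. *)
Definition is_orientation A (om : {set T} -> int) : Prop :=
  (forall F, F \in flags A -> om F = 1 \/ om F = -1) /\
  (forall F G, flag_adj A F G -> om G = - om F).

(* [om x] is the chosen orientation of the cell [x]. *)
Definition orientation_choice (om : T -> {set T} -> int) : Prop :=
  (forall x, is_orientation (cl x) (om x)) /\
  (forall v, rk v = 0%N -> om v [set v] = 1).

End RankedPoset.

(* The homology at [V] of [U --f--> V --g--> W], as the quotient of the subgroup
   [ker g] by those of its elements that are in the image of [f]. *)
Section Homology.
Variables (U V W : zmodType) (f : {additive U -> V}) (g : {additive V -> W}).

Definition ker_pred : {pred V} := fun v => g v == 0.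

Lemma ker_pred_zmod_closed : zmod_closed ker_pred.
Proof.
split=> [|u v]; rewrite /ker_pred !unfold_in; first by rewrite raddf0.
by rewrite raddfB => /eqP -> /eqP ->; rewrite subr0.
Qed.

HB.instance Definition _ := GRing.isZmodClosed.Build V ker_pred
  ker_pred_zmod_closed.

Definition cycles : Type := {v : V | ker_pred v}.
HB.instance Definition _ := SubChoice.on cycles.
HB.instance Definition _ := [SubChoice_isSubZmodule of cycles by <:].

Definition im_pred : {pred cycles} :=
  fun z => boolp.asbool (exists u : U, f u = val z).

Lemma im_pred_zmod_closed : zmod_closed im_pred.
Proof.
split=> [|y z]; rewrite !unfold_in.
  by apply/boolp.asboolP; exists 0; rewrite !raddf0.
move=> /boolp.asboolP[u fu] /boolp.asboolP[v fv]; apply/boolp.asboolP.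
by exists (u - v); rewrite !raddfB fu fv.
Qed.

HB.instance Definition _ := GRing.isZmodClosed.Build cycles im_pred
  im_pred_zmod_closed.

Definition homology : zmodType := Quotient.quot im_pred.

End Homology.

Arguments im_pred {U V W} f g z.

Definition zmod_iso (U V : zmodType) : Prop :=
  exists f : {additive U -> V}, bijective f.

Definition zmod_trivial (U : zmodType) : Prop := forall u : U, u = 0.

Section CellComplex.
Context {d : Order.disp_t} {T : finPOrderType d}.
Variables (rk : T -> nat) (om : T -> {set T} -> int).
Implicit Types (x y z : T) (A : {set T}) (i j : int).

(* When [cl y] is flag-connected this does not depend on the flag picked. *)
Definition incidence x y : int :=
  if [pick F in flags rk (cl x) | y \in F] is Some F
  then om x F / om y (F :\ x) else 0.

(* Degrees are integers; there are no cells of negative degree. *)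
Definition cells A i : finType := {x : T | (x \in A) && ((rk x)%:Z == i)}.

(* The free abelian group on [cells A i]. *)
Definition chain A i : zmodType := {ffun cells A i -> int}.

(* The degree [i -> j] component of the boundary operator; it vanishes unless
   [j = i - 1].  The coefficient of [y] in the boundary of [c] is the sum of
   [c x * incidence x y] over the co-faces [x] of [y]; similarly below. *)
Definition bd A i j (c : chain A i) : chain A j :=
  [ffun y : cells A j =>
     \sum_(x : cells A i | val y \in faces rk (val x))
        c x * incidence (val x) (val y)].

(* The degree [i -> j] component of the coboundary operator; it vanishes unless
   [j = i + 1]. *)
Definition cobd A i j (c : chain A i) : chain A j :=
  [ffun z : cells A j =>
     \sum_(x : cells A i | val x \in faces rk (val z))
        c x * incidence (val z) (val x)].

Lemma bd_zmod_morphism A i j : zmod_morphism (@bd A i j).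
Proof.
move=> c c'; apply/ffunP=> y; rewrite !ffunE -sumrB.
by apply: eq_bigr => x _; rewrite !ffunE mulrBl.
Qed.

HB.instance Definition _ A i j :=
  GRing.isZmodMorphism.Build (chain A i) (chain A j) (@bd A i j)
    (@bd_zmod_morphism A i j).

Lemma cobd_zmod_morphism A i j : zmod_morphism (@cobd A i j).
Proof.
move=> c c'; apply/ffunP=> y; rewrite !ffunE -sumrB.
by apply: eq_bigr => x _; rewrite !ffunE mulrBl.
Qed.

HB.instance Definition _ A i j :=
  GRing.isZmodMorphism.Build (chain A i) (chain A j) (@cobd A i j)
    (@cobd_zmod_morphism A i j).

Definition hlgy A i : zmodType :=
  homology (@bd A (i + 1) i) (@bd A i (i - 1)).

Definition cohlgy A i : zmodType :=
  homology (@cobd A (i - 1) i) (@cobd A i (i + 1)).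

Definition acyclic A : Prop :=
  (forall i, (0 < i)%R -> zmod_trivial (hlgy A i)) /\
  zmod_iso (hlgy A 0) int.

End CellComplex.

Definition dual_rk {d : Order.disp_t} {T : finPOrderType d} (n : nat)
  (rk : T -> nat) : T^d -> nat := fun x => (n - rk x)%N.

(* Main.v *)
From HB Require Import structures.
Require Import Defs.
From mathcomp Require Import all_boot all_order all_algebra.
From mathcomp Require Import ring_quotient zify ring.
From mathcomp Require boolp.

(** Poincare duality by the double complex of incident pairs of cells.

    Write S for the complex and S° for its dual.  Let D be the free abelian
    group on the pairs x <= y of cells, bigraded by the rank of x and the rank
    n - rk y of y°.  The boundary of S acts on x, the boundary of S° acts on
    y, and with the usual signs they give D a total differential.  For a fixed
    y the pairs x <= y form the chain complex of cl(y); for a fixed x the pairs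
    form the chain complex of cl(x°).  By hypothesis all of these are acyclic,
    so the two augmentations, which sum over the vertices x below y and over
    the top cells y above x, map the total complex onto C(S°) and C(S) with
    acyclic kernels ([aug_kernel_exact]).  A cycle of C(S) and a cycle of C(S°)
    are [linked] when they are the two augmentations of one total cycle.  Every
    cycle is linked to one on the other side ([linked_left], [linked_right]),
    and linked cycles bound simultaneously ([linked_boundary]), so H_i(S) and
    H_i(S°) are isomorphic ([homology_iso]).

    It remains to compare C(S°) with the cochains of S, and this is where the
    orientability of S itself enters.  A flag of S through x is a flag of cl(x)
    glued to a flag of cl(x°) along x.  The product of a global orientation
    with the orientations of x and x° on the two parts is a sign eps(x) that
    does not depend on the flag, because both parts vary in connected graphs.
    Comparing x with a face y of x along one flag gives
    s°(y°, x°) = eps(x) eps(y) s(x, y) ([dual_sign]), so rescaling by eps turns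
    the boundary of S° into the coboundary of S.

    The same cellular facts are needed for S and for S°, so they are proved
    once, for posets satisfying the self-dual axioms [thin_complex]. *)

Set Implicit Arguments.
Unset Strict Implicit.
Unset Printing Implicit Defensive.

Import Order.TTheory GRing.Theory.
Local Open Scope ring_scope.

(** * Flags and incidence numbers *)

(** Self-dual combinatorial axioms satisfied both by a manifold-like complex
    and by its dual.  Cellular homology only sees faces, the diamonds that make
    the boundary square to zero, and the two ends of each edge. *)
Record thin_complex {d : Order.disp_t} {T : finPOrderType d} (rk : T -> nat) :
    Prop := ThinComplex {
  thin_rk_lt : forall x y, (y < x)%O -> (rk y < rk x)%N;
  thin_face_above : forall x y, (y < x)%O ->
    exists2 z, z \in faces rk x & (y <= z)%O;
  thin_below : forall x, (0 < rk x)%N -> exists y, (y < x)%O;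
  thin_diamond : forall x y, (y < x)%O -> rk x = (rk y).+2 ->
    exists yp ym, yp != ym /\ faces rk x :&: cofaces rk y = [set yp; ym];
  thin_edge : forall x, rk x = 1%N ->
    exists v w, v != w /\ faces rk x = [set v; w]
}.

Section Flags.
Context {d : Order.disp_t} {T : finPOrderType d}.
Variable rk : T -> nat.
Hypothesis rk_lt : forall x y : T, (y < x)%O -> (rk y < rk x)%N.
Implicit Types (x y z : T) (A F G : {set T}).

Lemma rk_le x y : (y <= x)%O -> (rk y <= rk x)%N.
Proof. by rewrite le_eqVlt => /orP[/eqP -> // | /rk_lt /ltnW]. Qed.

Lemma comparable_rk_inj x y : (x >=< y)%O -> rk x = rk y -> x = y.
Proof.
move=> + e; case/comparable_ltgtP => // /rk_lt; by rewrite e ltnn.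
Qed.

Lemma comparable_rk_lt x y : (x >=< y)%O -> (rk x < rk y)%N -> (x < y)%O.
Proof.
case/comparable_ltgtP => // [/rk_lt h1 h2 | ->]; last by rewrite ltnn.
by have := ltn_trans h1 h2; rewrite ltnn.
Qed.

(** A flag is a chain in [A] meeting every rank up to the dimension: ranks
    separate the members of a chain, so such a set is automatically the image
    of a unique increasing enumeration by rank. *)
Lemma flagP A F : F \in flags rk A <->
  [/\ F \subset A, {in F &, forall x y, (x >=< y)%O}
    & forall k, (k <= ccdim rk A)%N -> exists2 z, z \in F & rk z = k].
Proof.
rewrite inE; split.
  case/existsP => f /and3P[/forallP fA /forallP f_lt /eqP ->]; split.
  - by apply/subsetP => _ /imsetP[i _ ->]; have /andP[] := fA i.
  - move=> _ _ /imsetP[i _ ->] /imsetP[j _ ->].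
    case: (ltngtP i j) => [ij|ji|/val_inj ->]; last exact: comparablexx.
      by apply: lt_comparable; have /forallP/(_ j)/implyP -> := f_lt i.
    by apply: gt_comparable; have /forallP/(_ i)/implyP -> := f_lt j.
  - move=> k; rewrite -ltnS => k_lt; exists (f (Ordinal k_lt)).
      exact: imset_f.
    by have /andP[_ /eqP] := fA (Ordinal k_lt).
case=> /subsetP FA Fchain Frk.
have /fin_all_exists[f fP] (i : 'I_(ccdim rk A).+1) :
    exists z, z \in F /\ rk z = i.
  by have [|z zF zi] := Frk i; [rewrite -ltnS | exists z].
have fF i : f i \in F by case: (fP i).
have frk i : rk (f i) = i by case: (fP i).
apply/existsP; exists (finfun f); apply/and3P; split.
- by apply/forallP => i; rewrite ffunE FA ?frk //=.
- apply/forallP => i; apply/forallP => j; apply/implyP => ij; rewrite !ffunE.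
  by apply: comparable_rk_lt; rewrite ?Fchain ?frk.
- apply/eqP/setP => z; apply/idP/imsetP => [zF|[i _ ->]]; last by rewrite ffunE.
  have z_lt : (rk z < (ccdim rk A).+1)%N.
    by rewrite ltnS; apply: leq_bigmax_cond; rewrite FA.
  exists (Ordinal z_lt); rewrite // ffunE; apply: comparable_rk_inj.
    exact: Fchain.
  by rewrite frk.
Qed.

Lemma ccdim_cl x : ccdim rk (cl x) = rk x.
Proof.
apply/eqP; rewrite eqn_leq; apply/andP; split.
  by apply/bigmax_leqP => y; rewrite inE => /rk_le.
by apply: leq_bigmax_cond; rewrite inE.
Qed.

Lemma flag_top x F : F \in flags rk (cl x) -> x \in F.
Proof.
case/flagP => /subsetP FA _ /(_ (rk x)).
rewrite ccdim_cl => /(_ (leqnn _))[z zF zx].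
have zlex : (z <= x)%O by have := FA _ zF; rewrite inE.
by rewrite -(comparable_rk_inj _ zx) // le_comparable.
Qed.

Lemma flag_le x F y : F \in flags rk (cl x) -> y \in F -> (y <= x)%O.
Proof. by case/flagP => /subsetP FA _ _ /FA; rewrite inE. Qed.

Lemma top_notin_flag x y G :
  (y < x)%O -> G \in flags rk (cl y) -> x \notin G.
Proof.
move=> yx Gfl; apply/negP => /(flag_le Gfl) xy.
by have := lt_le_trans yx xy; rewrite ltxx.
Qed.

Lemma flag_vertex v : rk v = 0%N -> [set v] \in flags rk (cl v).
Proof.
move=> v0; apply/flagP; split.
- by rewrite sub1set inE.
- by move=> x y /set1P -> /set1P ->; exact: comparablexx.
- by move=> k; rewrite ccdim_cl v0 leqn0 => /eqP ->; exists v; rewrite ?set11.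
Qed.

Lemma flagU1 x y G : y \in faces rk x -> G \in flags rk (cl y) ->
  x |: G \in flags rk (cl x).
Proof.
rewrite inE => /andP[yx /eqP rkx] Gfl; have [GA Gch Grk] := (flagP _ _).1 Gfl.
have Glt z : z \in G -> (z < x)%O by move=> /(flag_le Gfl) /le_lt_trans ->.
apply/flagP; split.
- apply/subsetP => z /setU1P[-> | /Glt /ltW]; by rewrite inE.
- move=> z z' /setU1P[-> | zG] /setU1P[-> | z'G]; last exact: Gch.
  + exact: comparablexx.
  + by rewrite gt_comparable ?Glt.
  + by rewrite lt_comparable ?Glt.
- move=> k; rewrite ccdim_cl leq_eqVlt => /orP[/eqP -> | ].
    by exists x; rewrite ?setU11.
  rewrite -rkx ltnS -ccdim_cl => /Grk[z zG zk].
  by exists z; rewrite ?setU1r.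
Qed.

Lemma flagD1 x y F : y \in faces rk x -> F \in flags rk (cl x) -> y \in F ->
  F :\ x \in flags rk (cl y).
Proof.
rewrite inE => /andP[yx /eqP rkx] Ffl yF.
have [FA Fch Frk] := (flagP _ _).1 Ffl.
apply/flagP; split.
- apply/subsetP => z /setD1P[zx zF]; rewrite inE.
  have zltx : (z < x)%O by rewrite lt_neqAle zx (flag_le Ffl).
  have /comparable_leP[//|yz] := Fch _ _ zF yF.
  have := leq_trans (rk_lt yz) (_ : rk z <= rk y)%N.
  by rewrite ltnn -ltnS rkx rk_lt // => /(_ isT).
- by move=> z z' /setD1P[_ zF] /setD1P[_ z'F]; exact: Fch.
- move=> k; rewrite ccdim_cl => ky; have [|z zF zk] := Frk k.
    by rewrite ccdim_cl -rkx ltnW // ltnS.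
  exists z => //; rewrite !inE zF andbT; apply/negP => /eqP zx.
  by move: ky; rewrite -zk zx -rkx ltnn.
Qed.

(** Adjacency survives gluing a common part [K] onto both flags.  The
    hypotheses compare bare sets, so that [F] and [G] may be flags for another
    order and rank on the same cells. *)
Lemma flag_adjU B F G K : #|F :\: G| == 1%N -> #|G :\: F| == 1%N ->
  K :|: F \in flags rk B -> K :|: G \in flags rk B ->
  (forall z, z \in K -> (z \in F) = (z \in G)) ->
  flag_adj rk B (K :|: F) (K :|: G).
Proof.
move=> FG GF KF KG KFG; rewrite /flag_adj KF KG /=.
suff H (U V : {set T}) : (forall z, z \in K -> (z \in U) = (z \in V)) ->
    (K :|: U) :\: (K :|: V) = U :\: V.
  by rewrite !H ?FG ?GF // => z /KFG.
move=> KUV; apply/setP => z; rewrite !inE.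
by have := KUV z; case: (z \in K) => //= ->; rewrite ?andNb.
Qed.

End Flags.

Lemma connect_invariant (T : finType) (R : Type) (e : rel T) (f : T -> R) :
  (forall x y, e x y -> f x = f y) -> forall x y, connect e x y -> f x = f y.
Proof.
move=> fe x y /connectP[p]; elim: p x => [|z p IH] x /=; first by move=> _ ->.
by move=> /andP[/fe -> /IH]; exact.
Qed.

Section Incidence.
Context {d : Order.disp_t} {T : finPOrderType d}.
Variables (rk : T -> nat) (om : T -> {set T} -> int).
Hypothesis thinT : thin_complex rk.
Hypothesis conT : forall x : T, flag_connected rk (cl x).
Hypothesis omP : orientation_choice rk om.
Implicit Types (x y z : T) (F G : {set T}).
Let rk_lt := thin_rk_lt thinT.

(** The incidence numbers as a matrix indexed by all pairs of cells, so that
    boundaries are plain matrix products. *)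
Definition inc x y : int := if y \in faces rk x then incidence rk om x y else 0.

Lemma faces_neq0 x : (0 < rk x)%N -> exists y, y \in faces rk x.
Proof.
by move=> /(thin_below thinT)[y /(thin_face_above thinT)[z zx _]]; exists z.
Qed.

Lemma flag_exists x : exists F, F \in flags rk (cl x).
Proof.
move e : (rk x) => k; elim: k x e => [|k IH] x xk.
  by exists [set x]; apply: flag_vertex.
have [|y yx] := @faces_neq0 x; first by rewrite xk.
have [|F Fy] := IH y; first by move: yx; rewrite inE xk => /andP[_ /eqP[]].
by exists (x |: F); apply: flagU1 Fy.
Qed.

Lemma orientation_sqr x F : F \in flags rk (cl x) -> om x F * om x F = 1.
Proof. by move=> /((omP.1 x).1)[] ->; rewrite ?mulr1 ?mulrNN ?mulr1. Qed.

Lemma orientation_inv x F : F \in flags rk (cl x) -> (om x F)^-1 = om x F.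
Proof. by move=> /((omP.1 x).1)[] ->; rewrite ?invr1 ?invrN1. Qed.

Lemma flag_adjU1 x y F G : y \in faces rk x ->
  flag_adj rk (cl y) F G -> flag_adj rk (cl x) (x |: F) (x |: G).
Proof.
move=> yx FG; have /and4P[Ffl Gfl FG1 GF1] := FG.
apply: (flag_adjU FG1 GF1); try exact: flagU1 yx _.
move: yx; rewrite inE => /andP[yx _] z /set1P ->.
by rewrite !(negbTE (top_notin_flag rk_lt yx _)).
Qed.

(** Any flag of [y] computes the incidence number: moving to an adjacent flag
    of [y] changes the sign of both factors, and the flags of [y] are
    connected. *)
Lemma incE x y G : y \in faces rk x -> G \in flags rk (cl y) ->
  inc x y = om x (x |: G) * om y G.
Proof.
move=> yx Gfl; rewrite /inc yx /incidence.
case: pickP => [F /andP[Ffl yF]|none].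
  have FDfl := flagD1 rk_lt yx Ffl yF.
  rewrite (orientation_inv FDfl) -{1}(setD1K (flag_top rk_lt Ffl)).
  apply: (@connect_invariant _ _ (flag_adj rk (cl y))
            (fun G => om x (x |: G) * om y G)); last exact: conT.
  move=> F1 F2 F12.
  by rewrite ((omP.1 x).2 _ _ (flag_adjU1 yx F12)) ((omP.1 y).2 _ _ F12) mulrNN.
have := none (x |: G).
by rewrite (flagU1 rk_lt yx Gfl) setU1r // (flag_top rk_lt Gfl).
Qed.

Lemma inc_neq0 x y : inc x y != 0 -> y \in faces rk x.
Proof. by rewrite /inc; case: ifP => // _; rewrite eqxx. Qed.

Lemma inc_rk x y : inc x y != 0 -> rk x = (rk y).+1.
Proof. by move/inc_neq0; rewrite inE => /andP[_ /eqP]. Qed.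

(** The two paths from [x] down to [z] contribute opposite terms: extended by
    one flag of [z], they are flags of [x] that differ only in the middle cell,
    hence are adjacent. *)
Lemma inc_sqr0 x z : \sum_y inc x y * inc y z = 0.
Proof.
have [zx|nzx] := boolP ((z < x)%O && (rk x == (rk z).+2)); last first.
  apply: big1 => y _; have [->|xy] := eqVneq (inc x y) 0; first by rewrite mul0r.
  have [->|yz] := eqVneq (inc y z) 0; first by rewrite mulr0.
  case/negP: nzx; move: (inc_rk xy) (inc_rk yz) (inc_neq0 xy) (inc_neq0 yz).
  rewrite !inE => -> -> /andP[yx _] /andP[zy _].
  by rewrite (lt_trans zy yx) eqxx.
case/andP: zx => zx /eqP rkx.
have [yp [ym [ypm e]]] := thin_diamond thinT zx rkx.
have [G Gfl] := flag_exists z.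
have out y : y != yp -> y != ym -> inc x y * inc y z = 0.
  move=> yyp yym; apply/eqP; rewrite mulf_eq0; apply/orP.
  have [|xy] := eqVneq (inc x y) 0; first by left.
  have [|yz] := eqVneq (inc y z) 0; first by right.
  have : y \in [set yp; ym].
    by rewrite -e inE (inc_neq0 xy) inE (inc_neq0 yz).
  by rewrite !inE (negbTE yyp) (negbTE yym).
have inE' y : y \in [set yp; ym] -> y \in faces rk x /\ z \in faces rk y.
  by rewrite -e => /setIP[yx]; rewrite [_ \in cofaces _ _]inE.
have val y : y \in [set yp; ym] ->
    inc x y * inc y z = om x (x |: (y |: G)) * om z G.
  case/inE' => yx zy; have yG := flagU1 rk_lt zy Gfl.
  rewrite (incE yx yG) (incE zy Gfl) mulrA -[X in X * _]mulrA.
  by rewrite orientation_sqr // mulr1.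
rewrite (bigD1 yp) //= (bigD1 ym) 1?eq_sym //= big1 ?addr0; last first.
  by move=> y /andP[]; apply: out.
rewrite !val ?set21 ?set22 // -mulrDl.
have [ypx zyp] := inE' _ (set21 yp ym).
have [ymx zym] := inE' _ (set22 yp ym).
suff /((omP.1 x).2) -> : flag_adj rk (cl x) (x |: (yp |: G)) (x |: (ym |: G)).
  by rewrite subrr mul0r.
have fp := flagU1 rk_lt ypx (flagU1 rk_lt zyp Gfl).
have fm := flagU1 rk_lt ymx (flagU1 rk_lt zym Gfl).
rewrite /flag_adj fp fm /=.
suff D y y' : y \in [set yp; ym] -> y != y' ->
    (x |: (y |: G)) :\: (x |: (y' |: G)) = [set y].
  by rewrite !D ?set21 ?set22 ?cards1 // eq_sym.
case/inE' => yx zy yy'; apply/setP => u; rewrite !inE !negb_or.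
have [->|uy] := eqVneq u y; last first.
  by rewrite /=; case: (u == x) => //=; case: (u \in G); rewrite ?andbF.
move: yx zy; rewrite !inE => /andP[yx _] /andP[zy _].
by rewrite yy' (top_notin_flag rk_lt zy Gfl) (lt_eqF yx) ?orbT.
Qed.

(** The two ends of an edge give adjacent flags of it, and vertices are
    positively oriented. *)
Lemma inc_edge x : rk x = 1%N -> \sum_y inc x y = 0.
Proof.
move=> x1; have [v [w [vw e]]] := thin_edge thinT x1.
have rk0 y : y \in [set v; w] -> rk y = 0%N.
  by rewrite -e inE x1 => /andP[_ /eqP[]].
have ltx y : y \in [set v; w] -> (y < x)%O by rewrite -e inE => /andP[].
have val y : y \in [set v; w] -> inc x y = om x [set x; y].
  move=> yvw; have y0 := rk0 _ yvw.
  rewrite (@incE x y [set y]); last exact: flag_vertex.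
    by rewrite omP.2 // mulr1.
  by rewrite e.
rewrite (bigD1 v) //= (bigD1 w) 1?eq_sym //= big1 ?addr0; last first.
  move=> y /andP[yv yw]; rewrite /inc e !inE.
  by rewrite (negbTE yv) (negbTE yw).
rewrite !val ?set21 ?set22 //.
suff /((omP.1 x).2) -> : flag_adj rk (cl x) [set x; v] [set x; w].
  by rewrite subrr.
have fl y : y \in [set v; w] -> [set x; y] \in flags rk (cl x).
  move=> yvw; apply: (@flagU1 _ _ _ rk_lt x y); first by rewrite e.
  by apply: flag_vertex; rewrite // rk0.
rewrite /flag_adj !fl ?set21 ?set22 //=.
suff D y y' : y \in [set v; w] -> y != y' ->
    [set x; y] :\: [set x; y'] = [set y].
  by rewrite !D ?set21 ?set22 ?cards1 // eq_sym.
move=> /ltx yx yy'; apply/setP => u; rewrite !inE negb_or.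
have [->|uy] := eqVneq u y; first by rewrite yy' (lt_eqF yx).
by case: (u == x); rewrite ?andbF /= ?andbF.
Qed.

Lemma vertex_below y : exists2 x, (x <= y)%O & rk x = 0%N.
Proof.
have [F Ffl] := flag_exists y.
have [_ _ /(_ 0%N (leq0n _))[x xF x0]] := (flagP rk_lt _ _).1 Ffl.
by exists x; rewrite // (flag_le rk_lt Ffl).
Qed.

End Incidence.

(** * The complex and its dual *)

Section Manifold.
Context {d : Order.disp_t} {T : finPOrderType d}.
Variables (rk : T -> nat) (n : nat).
Hypothesis ccc : is_ccc rk.
Hypothesis dimT : ccdim rk [set: T] = n.
Hypothesis manT : manifold_like rk [set: T].
Implicit Types x y z : T.

Lemma rk_dim x : (rk x <= n)%N.
Proof. by rewrite -dimT; apply: leq_bigmax_cond; rewrite inE. Qed.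

(** The covering axiom climbs from [y]; the last step before reaching [x]
    passes through a face of [x]. *)
Lemma ccc_face_above x y :
  (y < x)%O -> exists2 z, z \in faces rk x & (y <= z)%O.
Proof.
move e : (rk x - rk y)%N => k; elim: k y e => [|k IH] y e yx.
  by move/eqP: e; rewrite subn_eq0 leqNgt (ccc_rk_lt ccc yx).
have [y' [rky' yy' ]] := ccc_step ccc yx; rewrite le_eqVlt => /orP[/eqP ex|y'x].
  by exists y; rewrite // inE yx -ex rky' /=.
have [|z zx y'z] := IH y' _ y'x; first by rewrite rky' subnS e.
by exists z; rewrite // (le_trans (ltW yy')).
Qed.

Lemma ccc_edge x : rk x = 1%N -> exists v w, v != w /\ faces rk x = [set v; w].
Proof.
move=> x1; have [[_ _ /(_ x (in_setT x) x1) edge] _] := manT.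
have /cards2P[v [w [vw e]]] := introT eqP edge; exists v, w; split=> //.
rewrite -e; apply/setP => z; rewrite !inE x1 eqSS /= andbC lt_neqAle.
by have [->|_] := eqVneq z x; rewrite ?x1 ?andbF.
Qed.

Lemma ccc_thin : thin_complex rk.
Proof.
split.
- exact: ccc_rk_lt.
- exact: ccc_face_above.
- move=> x /(ccc_lub_faces ccc)[/set0Pn[y] + _].
  by rewrite inE => /andP[yx _]; exists y.
- move=> x y yx rkx; have [yp [ym [ypm e _]]] := ccc_diamond ccc yx rkx.
  by exists yp, ym.
- exact: ccc_edge.
Qed.

Lemma maximal_rk x : maximal_in [set: T] x = (rk x == n).
Proof.
have [[equidim _ _] _] := manT.
apply/idP/eqP => [xmax|xn]; first by rewrite -dimT; apply: equidim.
rewrite /maximal_in inE; apply/forall_inP => y _; apply/negP.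
by move/(ccc_rk_lt ccc); rewrite xn ltnNge rk_dim.
Qed.

Lemma above_nonmaximal x : (rk x < n)%N -> exists y, (x < y)%O.
Proof.
move=> xn; have : ~~ maximal_in [set: T] x by rewrite maximal_rk ltn_eqF.
by rewrite /maximal_in inE /= => /forall_inPn[y _]; rewrite negbK; exists y.
Qed.

Lemma maximal_above_exists x : exists2 y, (x <= y)%O & rk y = n.
Proof.
move e : (n - rk x)%N => k; elim: k x e => [|k IH] x e.
  by exists x => //; apply/eqP; rewrite eqn_leq rk_dim -subn_eq0 e.
have [|y xy] := @above_nonmaximal x; first by rewrite -subn_gt0 e.
have [x' [rkx' xx' _]] := ccc_step ccc xy.
have [|z x'z zn] := IH x'; first by rewrite rkx' subnS e.
by exists z; rewrite // (le_trans (ltW xx')).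
Qed.

(** The edges of the dual: non-singularity bounds the number of maximal cells
    above [x] by two, equidimensionality provides at least one, and there is no
    boundary, where that number would be one. *)
Lemma manifold_codim1 x : (rk x).+1 = n ->
  exists v w, v != w /\ [set y | (x < y)%O & rk y == n] = [set v; w].
Proof.
move=> xn; set M := [set y | _ & _].
have xltn : (rk x < n)%N by rewrite -xn.
have M_above : maximal_above [set: T] x = M.
  apply/setP => y; rewrite !inE maximal_rk andbC lt_neqAle.
  case: eqP => // [yn|_]; last by rewrite !andbF.
  by have [xy|//] := eqVneq x y; move: xltn; rewrite xy yn ltnn.
have M_le2 : (#|M| <= 2)%N.
  have [[_ /(_ x (in_setT x)) + _] _] := manT; rewrite dimT xn => /(_ erefl).
  apply: leq_trans; apply: subset_leq_card; apply/subsetP => y.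
  by rewrite !inE maximal_rk xn => /andP[-> yn]; rewrite (eqP yn) eqxx.
have M_neq0 : (0 < #|M|)%N.
  have [y xy yn] := maximal_above_exists x.
  by apply/card_gt0P; exists y; rewrite -M_above inE maximal_rk yn eqxx.
have M_neq1 : #|M| != 1%N.
  apply/negP => M1; have : x \in boundary rk [set: T].
    by rewrite !inE dimT xltn M_above.
  by rewrite manT.2 inE.
have /cards2P[v [w [vw e]]] : #|M| == 2%N.
  by case: #|M| M_le2 M_neq0 M_neq1 => [|[|[|]]].
by exists v, w.
Qed.

Lemma dual_facesE x y :
  ((x : T^d) \in faces (dual_rk n rk) (y : T^d)) = ((y : T) \in faces rk x).
Proof.
rewrite !inE; congr (_ && _); move: (rk_dim x) (rk_dim y).
by rewrite /dual_rk => xn yn; apply/eqP/eqP; lia.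
Qed.

Lemma dual_thin : thin_complex (dual_rk n rk).
Proof.
split.
- move=> x y; rewrite ltEdual => /(ccc_rk_lt ccc) xy.
  by rewrite ltn_sub2l // (leq_trans xy) // rk_dim.
- move=> x y; rewrite ltEdual => /(ccc_step ccc)[z [rkz xz zy]].
  by exists z => //; rewrite dual_facesE inE xz rkz /=.
- by move=> x; rewrite subn_gt0 => /above_nonmaximal[y]; exists y.
- move=> x y; rewrite ltEdual => xy e.
  have [|yp [ym [ypm ypmE _]]] := ccc_diamond ccc xy.
    by move: e (rk_dim x) (rk_dim y) => /=; rewrite /dual_rk; lia.
  exists yp, ym; split=> //.
  apply/setP => z; rewrite -ypmE !in_setI andbC; congr (_ && _).
    by rewrite [LHS]in_set dual_facesE.
  by rewrite [RHS]in_set dual_facesE.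
- move=> x x1; have xn : (rk x).+1 = n.
    by move: x1 (rk_dim x); rewrite /dual_rk; lia.
  have [v [w [vw e]]] := manifold_codim1 xn.
  exists v, w; split=> //; rewrite -e; apply/setP => y.
  by rewrite dual_facesE !inE xn eq_sym.
Qed.

End Manifold.

Section DualSign.
Context {d : Order.disp_t} {T : finPOrderType d}.
Variables (rk : T -> nat) (n : nat).
Hypothesis thinT : thin_complex rk.
Hypothesis thinD : thin_complex (dual_rk n rk).
Hypothesis dimT : ccdim rk [set: T] = n.
Hypothesis conT : forall x : T, flag_connected rk (cl x).
Hypothesis conD : forall x : T^d, flag_connected (dual_rk n rk) (cl x).
Hypothesis bipT : flag_bipartite rk [set: T].
Variables (om : T -> {set T} -> int) (om' : T^d -> {set T^d} -> int).
Hypothesis omP : orientation_choice rk om.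
Hypothesis om'P : orientation_choice (dual_rk n rk) om'.
Implicit Types (x y z : T) (G : {set T}) (H : {set T^d}).

Let rk_lt := thin_rk_lt thinT.
Let drk_lt := thin_rk_lt thinD.

Lemma flag_glue x G H :
  G \in flags rk (cl x) -> H \in flags (dual_rk n rk) (cl (x : T^d)) ->
  G :|: (H : {set T}) \in flags rk [set: T].
Proof.
move=> Gfl Hfl; have [_ Gch Grk] := (flagP rk_lt _ _).1 Gfl.
have [_ Hch Hrk] := (flagP drk_lt _ _).1 Hfl.
have Gx z : z \in G -> (z <= x)%O := flag_le rk_lt Gfl.
have Hx z : z \in (H : {set T}) -> (x <= z)%O := flag_le drk_lt Hfl.
apply/(flagP rk_lt); split; first exact: subsetT.
- move=> y z /setUP[yG|yH] /setUP[zG|zH].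
  + exact: Gch.
  + by apply: le_comparable; apply: le_trans (Gx _ yG) (Hx _ zH).
  + by apply: ge_comparable; apply: le_trans (Gx _ zG) (Hx _ yH).
  + by have := Hch _ _ yH zH; rewrite /Order.comparable !leEdual orbC.
- move=> k; rewrite dimT => kn; case: (leqP k (rk x)) => [kx|xk].
    have [|z zG zk] := Grk k; first by rewrite ccdim_cl.
    by exists z; rewrite // inE zG.
  have [|z zH] := Hrk (n - k)%N.
    by rewrite (ccdim_cl drk_lt) leq_sub2l // ltnW.
  have := rk_le rk_lt (Hx z zH); have : (rk z <= n)%N.
    by rewrite -dimT; apply: leq_bigmax_cond; rewrite inE.
  rewrite /dual_rk => zn xz e; exists z; last by move: e; lia.
  by rewrite inE orbC zH.
Qed.

Lemma flag_glue_meet x G H z :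
  G \in flags rk (cl x) -> H \in flags (dual_rk n rk) (cl (x : T^d)) ->
  z \in G -> z \in (H : {set T}) -> z = x.
Proof.
move=> Gfl Hfl /(flag_le rk_lt Gfl) zx /(flag_le drk_lt Hfl) xz.
by apply/eqP; rewrite eq_le zx.
Qed.

(** The sign of [x] is the product of a global orientation with the
    orientations of [x] and of its dual cell along any flag through [x].  A
    single flag through [x] and a face [y] computes both signs and both
    incidence numbers, whence the identity. *)
Lemma dual_sign : exists eps : T -> int,
  (forall x, eps x * eps x = 1) /\
  (forall x y, inc (dual_rk n rk) om' y x = eps x * eps y * inc rk om x y).
Proof.
have [col colP] := bipT.
pose sgn (F : {set T}) : int := (-1) ^+ col F.
have sgn_adj F F' : flag_adj rk [set: T] F F' -> sgn F = - sgn F'.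
  by move/colP; rewrite /sgn; case: (col F); case: (col F').
have sgn_sqr F : sgn F * sgn F = 1 by rewrite /sgn; case: (col F).
pose loc x G H := sgn (G :|: (H : {set T})) * om x G * om' x H.
(* Moving one half of the flag changes the global sign and one local sign. *)
have loc_l x H G G' : H \in flags (dual_rk n rk) (cl (x : T^d)) ->
    G \in flags rk (cl x) -> G' \in flags rk (cl x) -> loc x G H = loc x G' H.
  move=> Hfl Gfl G'fl.
  apply: (@connect_invariant _ _ (flag_adj rk (cl x)) (fun G => loc x G H));
    last exact: conT.
  move=> /= F F' FF'; have /and4P[Ffl F'fl F1 F'1] := FF'.
  rewrite /loc ((omP.1 x).2 _ _ FF') (sgn_adj _ (F' :|: (H : {set T}))).
    by rewrite mulrN !mulNr.
  rewrite ![_ :|: (H : {set T})]setUC; apply: flag_adjU => //.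
  - by rewrite setUC; exact: flag_glue Hfl.
  - by rewrite setUC; exact: flag_glue Hfl.
  - move=> z zH; apply/idP/idP => zF; rewrite (flag_glue_meet _ Hfl zF zH) //.
      exact: (@flag_top _ _ _ rk_lt x F').
    exact: (@flag_top _ _ _ rk_lt x F).
have loc_r x G H H' : G \in flags rk (cl x) ->
    H \in flags (dual_rk n rk) (cl (x : T^d)) ->
    H' \in flags (dual_rk n rk) (cl (x : T^d)) -> loc x G H = loc x G H'.
  move=> Gfl Hfl H'fl.
  apply: (@connect_invariant _ _ (flag_adj (dual_rk n rk) (cl (x : T^d)))
            (fun H => loc x G H)); last exact: conD.
  move=> F F' FF'; have /and4P[Ffl F'fl F1 F'1] := FF'.
  rewrite /loc ((om'P.1 x).2 _ _ FF') (sgn_adj _ (G :|: (F' : {set T}))).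
    by rewrite mulrN !mulNr.
  apply: flag_adjU; [exact: F1 | exact: F'1 | exact: (flag_glue Gfl Ffl)
    | exact: (flag_glue Gfl F'fl) | ].
  move=> z zG; apply/idP/idP => zF.
    by rewrite (flag_glue_meet Gfl Ffl zG zF); exact: (flag_top drk_lt F'fl).
  by rewrite (flag_glue_meet Gfl F'fl zG zF); exact: (flag_top drk_lt Ffl).
have /fin_all_exists[eps epsE] (x : T) : exists e, forall G H,
    G \in flags rk (cl x) -> H \in flags (dual_rk n rk) (cl (x : T^d)) ->
    loc x G H = e.
  have [G0 G0fl] := flag_exists thinT x.
  have [H0 H0fl] := flag_exists thinD (x : T^d).
  exists (loc x G0 H0) => G H Gfl Hfl.
  by rewrite (loc_l _ _ _ G0) // (loc_r _ _ _ H0).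
exists eps; split=> [x | x y].
  have [G Gfl] := flag_exists thinT x.
  have [H Hfl] := flag_exists thinD (x : T^d).
  rewrite -(epsE x G H) // /loc mulrACA (orientation_sqr om'P Hfl) mulr1.
  by rewrite mulrACA (orientation_sqr omP Gfl) mulr1.
have [yx|yx] := boolP (y \in faces rk x); last first.
  by rewrite /inc dual_facesE // (negbTE yx) mulr0.
have xy : (x : T^d) \in faces (dual_rk n rk) (y : T^d) by rewrite dual_facesE.
have [G Gfl] := flag_exists thinT y.
have [H Hfl] := flag_exists thinD (x : T^d).
rewrite (incE thinT conT omP yx Gfl) (incE thinD conD om'P xy Hfl).
have xGfl := flagU1 rk_lt yx Gfl; have yHfl := flagU1 drk_lt xy Hfl.
rewrite -(epsE x _ _ xGfl Hfl) -(epsE y _ _ Gfl yHfl) /loc.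
(* The flag through both cells, split at x or at y. *)
have -> : (x |: G) :|: (H : {set T}) = G :|: ((y |: H) : {set T}).
  apply/setP => z; rewrite !inE; have [->|_] := eqVneq z x.
    by rewrite (flag_top drk_lt Hfl : x \in (H : {set T})) !orbT.
  have [->|_] := eqVneq z y; first by rewrite (flag_top rk_lt Gfl).
  by [].
have := sgn_sqr (G :|: ((y |: H) : {set T})).
have := orientation_sqr omP Gfl; have := orientation_sqr omP xGfl.
set e := sgn _; set p := om x _; set q := om y _; set r := om' x _.
set u := om' y _ => pp qq ee.
transitivity ((e * e) * (p * p) * (q * q) * (u * r)).
  by rewrite pp qq ee !mul1r.
by ring.
Qed.

End DualSign.

(** * Double complexes with acyclic rows and columns *)

Section Boundary.
Variables (X : finType) (s : X -> X -> int).
Implicit Types c : X -> int.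

Definition bnd c x : int := \sum_x' c x' * s x' x.

Lemma eq_bnd c c' : c =1 c' -> bnd c =1 bnd c'.
Proof. by move=> cc' x; apply: eq_bigr => x' _; rewrite cc'. Qed.

Lemma bnd0 c x : (forall x', c x' = 0) -> bnd c x = 0.
Proof. by move=> c0; apply: big1 => x' _; rewrite c0 mul0r. Qed.

Lemma bndB c c' x : bnd (fun x => c x - c' x) x = bnd c x - bnd c' x.
Proof. by rewrite -sumrB; apply: eq_bigr => x' _; rewrite mulrBl. Qed.

Lemma bndD c c' x : bnd (fun x => c x + c' x) x = bnd c x + bnd c' x.
Proof. by rewrite -big_split; apply: eq_bigr => x' _; rewrite mulrDl. Qed.

Lemma bndZ k c x : bnd (fun x => k * c x) x = k * bnd c x.
Proof. by rewrite mulr_sumr; apply: eq_bigr => x' _; rewrite mulrA. Qed.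

Lemma bnd_neq0 c x : bnd c x != 0 -> exists x', c x' != 0 /\ s x' x != 0.
Proof.
move=> nz; have /existsP[x' ] : [exists x', c x' * s x' x != 0].
  apply: contraNT nz; rewrite negb_exists => /forallP z0.
  by apply/eqP/big1 => x' _; apply/eqP; rewrite -[_ == _]negbK.
by rewrite mulf_eq0 negb_or => /andP[]; exists x'.
Qed.

End Boundary.

(** A complex of free abelian groups with a distinguished basis, augmented by
    the sum of the coefficients in degree 0. *)
Record based_complex (X : finType) (a : X -> nat) (s : X -> X -> int) :
    Prop := BasedComplex {
  based_deg : forall x x', s x x' != 0 -> a x = (a x').+1;
  based_sqr0 : forall x x', \sum_z s x z * s z x' = 0;
  based_aug : forall x, a x = 1%N -> \sum_x' s x x' = 0
}.

(** For each [y] the basis elements related to [y] span a subcomplex whose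
    augmented complex is exact.  The degree [p] is an integer because it arises
    as a difference of two degrees. *)
Record acyclic_fibres (X Y : finType) (a : X -> nat) (s : X -> X -> int)
    (R : X -> Y -> bool) : Prop := AcyclicFibres {
  fibre_closed : forall x x' y, s x x' != 0 -> R x y -> R x' y;
  fibre_vertex : forall y, exists2 x, R x y & a x = 0%N;
  fibre_exact : forall y (p : int) (c : X -> int),
    (forall x, c x != 0 -> R x y /\ (a x)%:Z = p) ->
    (forall x, bnd s c x = 0) -> (p = 0 -> \sum_x c x = 0) ->
    exists2 e, (forall x, e x != 0 -> R x y /\ (a x)%:Z = p + 1)
             & bnd s e =1 c
}.

Lemma bnd_sqr0 (X : finType) (a : X -> nat) (s : X -> X -> int)
    (c : X -> int) x :
  based_complex a s -> bnd s (bnd s c) x = 0.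
Proof.
move=> sC; rewrite /bnd; under eq_bigr do rewrite mulr_suml.
rewrite exchange_big big1 //= => x' _.
by under eq_bigr do rewrite -mulrA; rewrite -mulr_sumr (based_sqr0 sC) mulr0.
Qed.

Section DoubleComplex.
Variables (X Y : finType) (a : X -> nat) (b : Y -> nat).
Variables (s : X -> X -> int) (t : Y -> Y -> int) (R : X -> Y -> bool).
Variables (sigma : Y -> int) (tau : X -> int).
Implicit Types (w u : X -> Y -> int) (c : Y -> int) (i : int).

(** There is a sign on each of the two differentials: exchanging the roles of
    [X] and [Y] then exchanges [sigma] and [tau] and leaves the total
    differential alone, so that what holds for rows also holds for columns. *)
Definition total_bnd w x y : int :=
  sigma y * bnd s (w^~ y) x + tau x * bnd t (w x) y.

Definition aug w y : int := \sum_(x | a x == 0%N) w x y.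

Definition bideg i w :=
  forall x y, w x y != 0 -> R x y /\ (a x)%:Z + (b y)%:Z = i.

Hypothesis sC : based_complex a s.
Hypothesis tC : based_complex b t.
Hypothesis sF : acyclic_fibres a s R.
Hypothesis t_closed : forall y y' x, t y y' != 0 -> R x y -> R x y'.
Hypothesis sigma_sqr : forall y, sigma y * sigma y = 1.
Hypothesis tau0 : forall x, a x = 0%N -> tau x = 1.
Hypothesis total_sqr0 : forall w x y, total_bnd (total_bnd w) x y = 0.

Lemma total_ext w u x y : w =2 u -> total_bnd w x y = total_bnd u x y.
Proof.
move=> wu; rewrite /total_bnd (eq_bnd s (_ : w^~ y =1 u^~ y)) //.
by rewrite (eq_bnd t (wu x)).
Qed.

Lemma totalB w u x y :
  total_bnd (fun x y => w x y - u x y) x y = total_bnd w x y - total_bnd u x y.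
Proof.
rewrite /total_bnd (bndB s (w^~ y) (u^~ y)) bndB !mulrBr opprD.
by rewrite !addrA (addrAC (sigma y * _)).
Qed.

Lemma totalD w u x y :
  total_bnd (fun x y => w x y + u x y) x y = total_bnd w x y + total_bnd u x y.
Proof. by rewrite /total_bnd (bndD s (w^~ y) (u^~ y)) bndD !mulrDr addrACA. Qed.

Lemma augD w u y : aug (fun x y => w x y + u x y) y = aug w y + aug u y.
Proof. by rewrite /aug big_split. Qed.

Lemma augB w u y : aug (fun x y => w x y - u x y) y = aug w y - aug u y.
Proof. by rewrite /aug sumrB. Qed.

Lemma aug_eq0 w y : (forall x, a x = 0%N -> w x y = 0) -> aug w y = 0.
Proof. by move=> w0; apply: big1 => x /eqP; exact: w0. Qed.

Lemma bidegB i w u :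
  bideg i w -> bideg i u -> bideg i (fun x y => w x y - u x y).
Proof.
move=> wi ui x y; have [->|/wi //] := eqVneq (w x y) 0.
by rewrite sub0r oppr_eq0 => /ui.
Qed.

Lemma bidegD i w u :
  bideg i w -> bideg i u -> bideg i (fun x y => w x y + u x y).
Proof.
move=> wi ui x y; have [->|/wi //] := eqVneq (w x y) 0.
by rewrite add0r => /ui.
Qed.

Lemma bideg_total i w : bideg (i + 1) w -> bideg i (total_bnd w).
Proof.
move=> wi x y; rewrite /total_bnd; have [->|] := eqVneq (bnd s (w^~ y) x) 0.
  rewrite mulr0 add0r mulf_eq0 negb_or => /andP[_ /bnd_neq0[y' [/wi[xy' e] ty]]].
  split; first exact: t_closed xy'.
  by move: e; rewrite (based_deg tC ty) -addn1 PoszD addrA => /addIr.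
case/bnd_neq0 => x' [/wi[x'y e] sx] _; split; first exact: (fibre_closed sF) x'y.
by move: e; rewrite (based_deg sC sx) -addn1 PoszD addrAC => /addIr.
Qed.

(** Only elements of degree 1 have a boundary in degree 0, and their
    coefficients there cancel. *)
Lemma bnd_aug0 (e : X -> int) : \sum_(x | a x == 0%N) bnd s e x = 0.
Proof.
rewrite exchange_big big1 //= => x' _; rewrite -mulr_sumr.
have [x'1|x'1] := eqVneq (a x') 1%N.
  have := based_aug sC x'1; rewrite (bigID (fun x => a x == 0%N)) /=.
  rewrite [X in _ + X]big1 ?addr0 => [->|x ax]; first by rewrite mulr0.
  apply/eqP; apply: contraNT ax => /(based_deg sC).
  by rewrite x'1 => - [<-].
rewrite big1 ?mulr0 // => x /eqP ax; apply/eqP; apply: contraNT x'1.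
by move=> /(based_deg sC) ->; rewrite ax.
Qed.

Lemma aug_total w y : aug (total_bnd w) y = bnd t (aug w) y.
Proof.
rewrite /aug /total_bnd big_split /= -mulr_sumr bnd_aug0 mulr0 add0r.
under eq_bigr => x /eqP /tau0 -> do rewrite mul1r.
by rewrite exchange_big /=; apply: eq_bigr => y' _; rewrite mulr_suml.
Qed.

(** Exactness of one row.  The bound [0 < a x] records that the primitive
    lies in degree at least one, so that its augmentation vanishes. *)
Lemma row_primitive i q w y : bideg i w -> b y = q ->
  (forall x, bnd s (w^~ y) x = 0) -> aug w y = 0 ->
  exists e, (forall x, e x != 0 ->
               [/\ R x y, (0 < a x)%N & (a x)%:Z + (b y)%:Z = i + 1])
            /\ bnd s e =1 w^~ y.
Proof.
move=> wi byq sw0 aw0.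
have [p0|p0] := boolP (0 <= i - (b y)%:Z); last first.
  exists (fun=> 0); split=> [x|x]; first by rewrite eqxx.
  rewrite bnd0 //; apply/esym/eqP; apply: contraNT p0 => /wi[_ <-].
  by rewrite addrK.
have [|//|p_eq0|e e_supp e_bnd] :=
  @fibre_exact _ _ _ _ _ sF y (i - (b y)%:Z) (w^~ y).
- by move=> x /wi[xy <-]; rewrite addrK.
- rewrite (bigID (fun x => a x == 0%N)) /= [X in X + _]aw0 add0r.
  rewrite big1 // => x ax0; apply/eqP.
  apply: contraNT ax0 => /wi[_ e]; move/eqP: p_eq0.
  by rewrite -e addrK.
exists e; split=> // x /e_supp[xy ax]; split => //.
  by rewrite -ltz_nat ax ltzD1.
by rewrite ax addrAC subrK.
Qed.

(** The kernel of the augmentation is acyclic.  The restriction of a cycle [w]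
    to its rows of highest degree is a cycle for the row differential alone,
    because no higher row maps into it; subtracting the total boundary of a
    row-wise primitive lowers the highest degree. *)
Lemma aug_kernel_exact i w : bideg i w -> (forall x y, total_bnd w x y = 0) ->
  (forall y, aug w y = 0) ->
  exists u, [/\ bideg (i + 1) u, total_bnd u =2 w & forall y, aug u y = 0].
Proof.
(* The induction is on a strict bound q for the degrees of the rows of w. *)
have [q wq] : exists q, forall x y, w x y != 0 -> (b y < q)%N.
  by exists (\max_y b y).+1 => x y _; rewrite ltnS; exact: leq_bigmax.
elim: q w wq => [|q IH] w wq wi Dw0 aw0.
  exists (fun _ _ => 0); split=> [x y|x y|y]; first by rewrite eqxx.
  - rewrite /total_bnd !bnd0 // !mulr0 addr0; apply/esym/eqP.
    by rewrite -[_ == _]negbK; apply/negP => /wq.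
  - exact: aug_eq0.
have /fin_all_exists[e eP] (y : Y) : exists e : X -> int,
    (forall x, e x != 0 ->
       [/\ R x y, (0 < a x)%N, (a x)%:Z + (b y)%:Z = i + 1 & b y = q])
    /\ (b y = q -> forall x, sigma y * bnd s e x = w x y).
  have [byq|byq] := eqVneq (b y) q; last first.
    by exists (fun=> 0); split=> [x|/eqP]; [rewrite eqxx | rewrite (negbTE byq)].
  have tw0 x : bnd t (w x) y = 0.
    apply/eqP; rewrite -[_ == _]negbK; apply/negP.
    case/bnd_neq0 => y' [/wq + /(based_deg tC) e]; by rewrite e byq ltnn.
  have sw0 x : bnd s (w^~ y) x = 0.
    have := Dw0 x y; rewrite /total_bnd tw0 mulr0 addr0.
    by move/(congr1 ( *%R (sigma y))); rewrite mulrA sigma_sqr mul1r mulr0.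
  have [e [e_supp e_bnd]] := row_primitive wi byq sw0 (aw0 y).
  exists (fun x => sigma y * e x); split=> [x|_ x].
    by rewrite mulf_eq0 negb_or => /andP[_ /e_supp[]].
  by rewrite bndZ mulrA sigma_sqr mul1r e_bnd.
pose u0 x y := e y x.
have u0i : bideg (i + 1) u0 by move=> x y /(eP y).1[].
have au0 y : aug u0 y = 0.
  apply: aug_eq0 => x ax; apply/eqP; rewrite -[_ == _]negbK; apply/negP.
  by move=> /(eP y).1[_]; rewrite ax.
pose w' x y := w x y - total_bnd u0 x y.
have [||||u [ui Du au]] := IH w'.
- move=> x y; apply: contraR; rewrite -leqNgt => qy; rewrite /w' /total_bnd.
  rewrite [bnd t _ _](_ : _ = 0) ?mulr0 ?addr0; last first.
    apply/eqP; rewrite -[_ == _]negbK; apply/negP.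
    case/bnd_neq0 => y' [/(eP y').1[_ _ _ by'] /(based_deg tC)].
    by rewrite by' => qy'; rewrite qy' ltnn in qy.
  move: qy; rewrite leq_eqVlt => /orP[/eqP/esym/(eP y).2 -> | qy].
    by rewrite subrr.
  rewrite bnd0 ?mulr0 ?subr0.
    by rewrite -[_ == _]negbK; apply/negP => /wq; rewrite ltnS leqNgt qy.
  move=> x'; apply/eqP; rewrite -[_ == _]negbK; apply/negP.
  by move=> /(eP y).1[_ _ _ byq]; rewrite byq ltnn in qy.
- exact: bidegB wi (bideg_total u0i).
- by move=> x y; rewrite totalB Dw0 total_sqr0 subr0.
- by move=> y; rewrite augB aw0 aug_total bnd0 ?subr0.
exists (fun x y => u x y + u0 x y); split; first exact: bidegD.
- by move=> x y; rewrite totalD Du subrK.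
- by move=> y; rewrite augD au au0 addr0.
Qed.

Lemma aug_lift i c : (forall y, c y != 0 -> (b y)%:Z = i) ->
  exists2 w, bideg i w & aug w =1 c.
Proof.
move=> ci; have /fin_all_exists2[v vR v0] := fibre_vertex sF.
exists (fun x y => if x == v y then c y else 0).
  move=> x y; have [->|_] := eqVneq x (v y) => [/ci <-|]; last by rewrite eqxx.
  by rewrite v0 add0r.
move=> y; rewrite /aug (bigD1 (v y)) ?v0 //= eqxx [X in _ + X]big1 ?addr0 // => x.
by case/andP => _ /negbTE ->.
Qed.

Lemma aug_cycle w : (forall x y, total_bnd w x y = 0) ->
  forall y, bnd t (aug w) y = 0.
Proof. by move=> Dw0 y; rewrite -aug_total aug_eq0. Qed.

Lemma aug_bideg i w : bideg i w -> forall y, aug w y != 0 -> (b y)%:Z = i.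
Proof.
move=> wi y; apply: contraNeq => yi; rewrite aug_eq0 // => x ax.
apply/eqP; apply: contraNT yi => /wi[_ <-].
by rewrite ax add0r.
Qed.

(** Choose any lift; its total boundary is a cycle in the kernel of the
    augmentation, hence the boundary of a correction with zero augmentation. *)
Lemma aug_lift_cycle i c : (forall y, c y != 0 -> (b y)%:Z = i) ->
  (forall y, bnd t c y = 0) ->
  exists w, [/\ bideg i w, forall x y, total_bnd w x y = 0 & aug w =1 c].
Proof.
move=> /aug_lift[w wi wc] tc0.
have Dwi : bideg (i - 1) (total_bnd w) by apply: bideg_total; rewrite subrK.
have [//||u [ui Du au]] := aug_kernel_exact Dwi.
  by move=> y; rewrite aug_total (eq_bnd _ wc).
exists (fun x y => w x y - u x y); split.
- by apply: bidegB wi _; rewrite subrK in ui.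
- by move=> x y; rewrite totalB Du subrr.
- by move=> y; rewrite augB au subr0.
Qed.

Lemma aug_boundary i w : bideg i w -> (forall x y, total_bnd w x y = 0) ->
  (exists2 c, forall y, c y != 0 -> (b y)%:Z = i + 1 & bnd t c =1 aug w) <->
  (exists2 u, bideg (i + 1) u & total_bnd u =2 w).
Proof.
move=> wi Dw0; split=> [[c /aug_lift[u ui uc] tc]|[u ui Du]]; last first.
  exists (aug u); first exact: aug_bideg.
  by move=> y; rewrite -aug_total; apply: eq_bigr => x _; rewrite Du.
have [|||v [vi Dv av]] := @aug_kernel_exact i (fun x y => w x y - total_bnd u x y).
- exact: bidegB wi (bideg_total ui).
- by move=> x y; rewrite totalB Dw0 total_sqr0 subrr.
- by move=> y; rewrite augB aug_total (eq_bnd _ uc) tc subrr.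
exists (fun x y => u x y + v x y); first exact: bidegD.
by move=> x y; rewrite totalD Dv addrC subrK.
Qed.

End DoubleComplex.

(** The cross terms cancel because a step down in [X] flips the sign in front
    of the differential of [Y]. *)
Lemma total_sqr0 (X Y : finType) (a : X -> nat) (b : Y -> nat)
    (s : X -> X -> int) (t : Y -> Y -> int) (w : X -> Y -> int) x y :
  based_complex a s -> based_complex b t ->
  let D := total_bnd s t (fun=> 1) (fun x => (-1) ^+ a x) in
  D (D w) x y = 0.
Proof.
move=> sC tC D; rewrite /D {1}/total_bnd mul1r.
rewrite [bnd s _ x](_ : _ = - ((-1) ^+ a x * \sum_x' bnd t (w x') y * s x' x)).
  rewrite [bnd t _ y](_ : _ = \sum_x' bnd t (w x') y * s x' x) ?addNr //.
  transitivity (bnd t (fun y => bnd s (w^~ y) x) y +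
                (-1) ^+ a x * bnd t (bnd t (w x)) y).
    by rewrite -bndZ -bndD; apply: eq_bnd => y'; rewrite /total_bnd mul1r.
  rewrite (bnd_sqr0 _ _ tC) mulr0 addr0 /bnd.
  under eq_bigr do rewrite mulr_suml.
  rewrite exchange_big /=; apply: eq_bigr => x' _; rewrite mulr_suml.
  by apply: eq_bigr => y' _; rewrite mulrAC.
transitivity (bnd s (bnd s (w^~ y)) x +
              \sum_x' (-1) ^+ a x' * bnd t (w x') y * s x' x).
  by rewrite -big_split; apply: eq_bigr => x' _; rewrite /total_bnd mul1r mulrDl.
rewrite (bnd_sqr0 _ _ sC) add0r mulr_sumr -sumrN; apply: eq_bigr => x' _.
have [->|/(based_deg sC) ->] := eqVneq (s x' x) 0; first by rewrite !mulr0 oppr0.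
by rewrite exprS mulN1r !mulNr mulrA.
Qed.

Lemma total_swap (X Y : finType) (s : X -> X -> int) (t : Y -> Y -> int)
    sigma tau (w : X -> Y -> int) x y :
  total_bnd t s tau sigma (fun y x => w x y) y x = total_bnd s t sigma tau w x y.
Proof. exact: addrC. Qed.

Section Linked.
Variables (X Y : finType) (a : X -> nat) (b : Y -> nat).
Variables (s : X -> X -> int) (t : Y -> Y -> int) (R : X -> Y -> bool).
Hypothesis sC : based_complex a s.
Hypothesis tC : based_complex b t.
Hypothesis sF : acyclic_fibres a s R.
Hypothesis tF : acyclic_fibres b t (fun y x => R x y).
Implicit Types (f : X -> int) (g : Y -> int) (w : X -> Y -> int) (i : int).

Let sgn (x : X) : int := (-1) ^+ a x.
Let D := total_bnd s t (fun=> 1) sgn.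

(** A correspondence on the chains themselves, realising on homology the
    composite of the inverse of one augmentation with the other. *)
Definition linked i f g := exists w,
  [/\ bideg a b R i w, forall x y, D w x y = 0,
      aug b (fun y x => w x y) =1 f & aug a w =1 g].

Lemma eq_linked i f g f' g' : linked i f g -> f =1 f' -> g =1 g' ->
  linked i f' g'.
Proof.
move=> [w [wi Dw wf wg]] ff' gg'; exists w; split=> // [x|y].
  by rewrite wf ff'.
by rewrite wg gg'.
Qed.

Lemma linkedB i f g f' g' : linked i f g -> linked i f' g' ->
  linked i (fun x => f x - f' x) (fun y => g y - g' y).
Proof.
move=> [w [wi Dw wf wg]] [w' [w'i Dw' w'f w'g]].
exists (fun x y => w x y - w' x y); split; first exact: bidegB.
- by move=> x y; rewrite /D totalB [total_bnd _ _ _ _ w _ _]Dw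
    [total_bnd _ _ _ _ w' _ _]Dw' subrr.
- by move=> x; rewrite augB wf w'f.
- by move=> y; rewrite augB wg w'g.
Qed.

Let sgn_sqr x : sgn x * sgn x = 1. Proof. by rewrite -expr2 sqrr_sign. Qed.
Let sgn0 x : a x = 0%N -> sgn x = 1. Proof. by rewrite /sgn => ->. Qed.
Let one_sqr (y : Y) : 1 * 1 = 1 :> int. Proof. exact: mulr1. Qed.
Let D_sqr0 w x y : D (D w) x y = 0. Proof. exact: (total_sqr0 _ _ _ sC tC). Qed.

Let D' := total_bnd t s sgn (fun=> 1).
Let D'_sqr0 (v : Y -> X -> int) y x : D' (D' v) y x = 0.
Proof.
rewrite -(D_sqr0 (fun x y => v y x) x y).
rewrite [LHS](total_swap _ _ _ _ (fun x y => D' v y x)).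
by apply: total_ext => x' y'; exact: total_swap.
Qed.

Let bideg_swap i w : bideg a b R i w <->
  bideg b a (fun y x => R x y) i (fun y x => w x y).
Proof. by split=> wi x y /wi[? <-]; rewrite addrC. Qed.

Let t_closed y y' x : t y y' != 0 -> R x y -> R x y'.
Proof. exact: (fibre_closed tF). Qed.
Let s_closed x x' y : s x x' != 0 -> R x y -> R x' y.
Proof. exact: (fibre_closed sF). Qed.

Lemma linked_cycle i f g : linked i f g ->
  [/\ forall x, f x != 0 -> (a x)%:Z = i, forall x, bnd s f x = 0,
      forall y, g y != 0 -> (b y)%:Z = i & forall y, bnd t g y = 0].
Proof.
move=> [w [wi Dw wf wg]]; have /bideg_swap w'i := wi; split=> [x|x|y|y].
- by rewrite -wf; exact: (aug_bideg w'i).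
- rewrite -(eq_bnd _ wf); apply: (aug_cycle (tau := fun=> 1) tC) => // y x'.
  by rewrite -[RHS](Dw x' y); exact: total_swap.
- by rewrite -wg; exact: (aug_bideg wi).
- by rewrite -(eq_bnd _ wg); exact: (aug_cycle sC sgn0 Dw).
Qed.

Lemma linked_right i f : (forall x, f x != 0 -> (a x)%:Z = i) ->
  (forall x, bnd s f x = 0) -> exists g, linked i f g.
Proof.
move=> f_supp sf0.
have [v [vi Dv vf]] :=
  aug_lift_cycle tC sC tF s_closed sgn_sqr (fun _ _ => erefl) D'_sqr0 f_supp sf0.
exists (aug a (fun x y => v y x)), (fun x y => v y x); split=> //.
  exact/bideg_swap.
by move=> x y; rewrite -[RHS](Dv y x); exact: esym (total_swap _ _ _ _ _ _ _).
Qed.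

Lemma linked_left i g : (forall y, g y != 0 -> (b y)%:Z = i) ->
  (forall y, bnd t g y = 0) -> exists f, linked i f g.
Proof.
move=> g_supp tg0.
have [w [wi Dw wg]] :=
  aug_lift_cycle sC tC sF t_closed one_sqr sgn0 D_sqr0 g_supp tg0.
by exists (aug b (fun y x => w x y)), w.
Qed.

(** Both conditions say that the total cycle realising the link is a total
    boundary. *)
Lemma linked_boundary i f g : linked i f g ->
  (exists2 c, forall x, c x != 0 -> (a x)%:Z = i + 1 & bnd s c =1 f) <->
  (exists2 c, forall y, c y != 0 -> (b y)%:Z = i + 1 & bnd t c =1 g).
Proof.
move=> [w [wi Dw wf wg]]; have /bideg_swap w'i := wi.
have D'w y x : D' (fun y x => w x y) y x = 0.
  by rewrite -[RHS](Dw x y); exact: total_swap.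
have := aug_boundary sC tC sF t_closed one_sqr sgn0 D_sqr0 wi Dw.
have := aug_boundary tC sC tF s_closed sgn_sqr (fun _ _ => erefl) D'_sqr0 w'i D'w.
move=> [l1 l2] [r1 r2]; split=> [[c c_supp cf]|[c c_supp cg]].
  have [|v vi Dv] := l1; first by exists c => // x; rewrite cf wf.
  have [|e e_supp eg] := r2.
    exists (fun x y => v y x); first exact/bideg_swap.
    by move=> x y; rewrite -[RHS](Dv y x); exact: esym (total_swap _ _ _ _ _ _ _).
  by exists e => // y; rewrite eg wg.
have [|v vi Dv] := r1; first by exists c => // y; rewrite cg wg.
have [|e e_supp ef] := l2.
  exists (fun y x => v x y); first exact/bideg_swap.
  by move=> y x; rewrite -[RHS](Dv x y); exact: total_swap.
by exists e => // x; rewrite ef wf.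
Qed.

End Linked.

(** * Homology classes *)

Section HomologyClass.
Variables (U V W : zmodType) (f : {additive U -> V}) (g : {additive V -> W}).

Definition hclass (z : cycles g) : homology f g :=
  (\pi_(Quotient.quot (im_pred f g)) z)%qT.

Lemma hclass_surj h : exists z, hclass z = h.
Proof. by exists (repr h); rewrite /hclass reprK. Qed.

Lemma hclassB : {morph hclass : y z / y - z}.
Proof. by move=> y z; rewrite /hclass !piE. Qed.

Lemma hclass_eq0 z : hclass z = 0 <-> exists u, f u = val z.
Proof.
have -> : 0 = hclass 0 by rewrite -[in RHS](subrr 0) hclassB subrr.
have : (z - 0 \in im_pred f g) = (hclass z == hclass 0).
  exact: Quotient.idealrBE.
rewrite subr0 => /esym e; split => [/eqP|h]; [|apply/eqP]; rewrite e.
  by move=> /boolp.asboolP.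
exact/boolp.asboolP.
Qed.

Lemma cycle_of v : g v = 0 -> exists z : cycles g, val z = v.
Proof. by move=> /eqP gv; exists (exist _ v gv). Qed.

Lemma cycleP (z : cycles g) : g (val z) = 0.
Proof. by apply/eqP; case: z. Qed.

End HomologyClass.

HB.instance Definition _ (U V W : zmodType) (f : {additive U -> V})
    (g : {additive V -> W}) :=
  GRing.isZmodMorphism.Build (cycles g) (homology f g) (@hclass U V W f g)
    (@hclassB U V W f g).

Section HomologyRelation.
Variables (U1 V1 W1 : zmodType) (f1 : {additive U1 -> V1})
          (g1 : {additive V1 -> W1}).
Variables (U2 V2 W2 : zmodType) (f2 : {additive U2 -> V2})
          (g2 : {additive V2 -> W2}).
Variable r : V1 -> V2 -> Prop.
Hypothesis rB : forall u1 u2 v1 v2, r u1 u2 -> r v1 v2 -> r (u1 - v1) (u2 - v2).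
Hypothesis r_left : forall v1, g1 v1 = 0 -> exists2 v2, g2 v2 = 0 & r v1 v2.
Hypothesis r_right : forall v2, g2 v2 = 0 -> exists2 v1, g1 v1 = 0 & r v1 v2.
Hypothesis r_im : forall v1 v2, r v1 v2 ->
  (exists u, f1 u = v1) <-> (exists u, f2 u = v2).

(** An additive relation between two complexes which is total on cycles on both
    sides and matches boundaries with boundaries induces an isomorphism on
    homology, although it need not be the graph of a chain map. *)
Lemma homology_iso : zmod_iso (homology f1 g1) (homology f2 g2).
Proof.
pose R (h1 : homology f1 g1) (h2 : homology f2 g2) := exists z1 z2,
  [/\ hclass f1 z1 = h1, hclass f2 z2 = h2 & r (val z1) (val z2)].
have Rl h1 : exists h2, R h1 h2.
  have [z1 <-] := hclass_surj h1; have [v2 gv2 rv2] := r_left (cycleP z1).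
  by have [z2 ez2] := cycle_of gv2; exists (hclass f2 z2), z1, z2; rewrite ez2.
have Rr h2 : exists h1, R h1 h2.
  have [z2 <-] := hclass_surj h2; have [v1 gv1 rv1] := r_right (cycleP z2).
  by have [z1 ez1] := cycle_of gv1; exists (hclass f1 z1), z1, z2; rewrite ez1.
have RB h1 h2 k1 k2 : R h1 h2 -> R k1 k2 -> R (h1 - k1) (h2 - k2).
  move=> [z1 [z2 [<- <- rz]]] [t1 [t2 [<- <- rt]]].
  by exists (z1 - t1), (z2 - t2); rewrite !hclassB; split => //; apply: rB.
have R0 h1 h2 : R h1 h2 -> h1 = 0 <-> h2 = 0.
  by move=> [z1 [z2 [<- <- /r_im rz]]]; rewrite !hclass_eq0.
have [phi phiP] := boolp.choice Rl.
have phiE h1 h2 : R h1 h2 -> phi h1 = h2.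
  move=> Rh; apply/eqP; rewrite -subr_eq0; apply/eqP.
  by apply: (R0 _ _ (RB _ _ _ _ (phiP h1) Rh)).1; rewrite subrr.
have [psi psiP] := boolp.choice Rr.
have phiB : zmod_morphism phi by move=> h k; apply/phiE/RB.
pose phiM := GRing.isZmodMorphism.Build _ _ phi phiB.
pose phi_add : {additive homology f1 g1 -> homology f2 g2} := HB.pack phi phiM.
exists phi_add; exists psi => h /=; last exact: phiE.
apply/eqP; rewrite -subr_eq0; apply/eqP.
by apply: (R0 _ _ (RB _ _ _ _ (psiP _) (phiP h))).2; rewrite subrr.
Qed.

End HomologyRelation.

(** * Cellular chains *)

Section Chains.
Context {d : Order.disp_t} {T : finPOrderType d}.
Variables (rk : T -> nat) (om : T -> {set T} -> int).
Implicit Types (x y z : T) (A : {set T}) (i j : int).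

Definition supported A i (f : T -> int) :=
  forall x, f x != 0 -> x \in A /\ (rk x)%:Z = i.

Definition restr A i (f : T -> int) : chain rk A i := [ffun x => f (val x)].

(** Extension by zero: chains of all degrees and subcomplexes become functions
    on the same set of cells. *)
Definition ext A i (c : chain rk A i) : T -> int :=
  fun x => if insub x is Some u then c u else 0.

Lemma ext_val A i (c : chain rk A i) u : ext c (val u) = c u.
Proof. by rewrite /ext valK. Qed.

Lemma ext_supported A i (c : chain rk A i) : supported A i (ext c).
Proof.
move=> x; rewrite /ext.
by case: insubP => [u /andP[xA /eqP xi] _ _|]; last by rewrite eqxx.
Qed.

Lemma restrK A i f : supported A i f -> ext (restr A i f) =1 f.
Proof.
move=> fs x; rewrite /ext; case: insubP => [u _ <-|]; first by rewrite ffunE.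
have [-> //|/fs[xA xi]] := eqVneq (f x) 0; by rewrite xA xi eqxx.
Qed.

Lemma sum_cells A i (P : pred T) (c : chain rk A i) (F : T -> int) :
  \sum_(u : cells rk A i | P (val u)) c u * F (val u) =
  \sum_(x | P x) ext c x * F x.
Proof.
rewrite [RHS](bigID [pred x | (x \in A) && ((rk x)%:Z == i)]) /=.
rewrite [X in _ + X]big1 ?addr0; last first.
  move=> x /andP[_]; rewrite /ext; case: insubP => [u -> //|_ _].
  by rewrite mul0r.
rewrite (eq_bigl (fun x =>
  (x \in [pred x | (x \in A) && ((rk x)%:Z == i)]) && P x)); last first.
  by move=> x; rewrite !inE andbC.
rewrite big_sub_cond; apply: eq_big => // u _.
by rewrite -ext_val.
Qed.

Lemma bd_val A i j (c : chain rk A i) (v : cells rk A j) :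
  bd om j c v = \sum_x ext c x * inc rk om x (val v).
Proof.
rewrite ffunE (sum_cells (fun x => val v \in faces rk x) c
                  (fun x => incidence rk om x (val v))).
by rewrite big_mkcond; apply: eq_bigr => x _; rewrite /inc; case: ifP; rewrite ?mulr0.
Qed.

Lemma cobd_val A i j (c : chain rk A i) (v : cells rk A j) :
  cobd om j c v = \sum_x ext c x * inc rk om (val v) x.
Proof.
rewrite ffunE (sum_cells (fun x => x \in faces rk (val v)) c
                  (fun x => incidence rk om (val v) x)).
by rewrite big_mkcond; apply: eq_bigr => x _; rewrite /inc; case: ifP; rewrite ?mulr0.
Qed.

End Chains.

Section ChainSum.
Context {d : Order.disp_t} {T : finPOrderType d}.
Variables (rk : T -> nat) (A : {set T}) (i : int).

Definition chain_sum (c : chain rk A i) : int := \sum_u c u.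

Lemma chain_sum_zmod_morphism : zmod_morphism chain_sum.
Proof.
by move=> c c'; rewrite -sumrB; apply: eq_bigr => u _; rewrite !ffunE.
Qed.

HB.instance Definition _ := GRing.isZmodMorphism.Build (chain rk A i) int
  chain_sum chain_sum_zmod_morphism.

Lemma chain_sum_ext c : chain_sum c = \sum_x ext c x.
Proof.
transitivity (\sum_(u : cells rk A i | predT (val u)) c u * 1).
  by apply: eq_bigr => u _; rewrite mulr1.
rewrite (sum_cells predT c (fun=> 1)).
by apply: eq_bigr => x _; rewrite mulr1.
Qed.

End ChainSum.

Section Extension.
Context {d : Order.disp_t} {T : finPOrderType d}.
Variables (rk : T -> nat) (om : T -> {set T} -> int).
Implicit Types (x y z : T) (A : {set T}) (i j : int).

Lemma ext_eq0 A i (c : chain rk A i) : c = 0 <-> ext c =1 (fun=> 0).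
Proof.
split=> [-> x|c0]; first by rewrite /ext; case: insub => // u; rewrite ffunE.
by apply/ffunP => u; rewrite -ext_val c0 ffunE.
Qed.

Lemma ext_eq A i (c c' : chain rk A i) : ext c =1 ext c' -> c = c'.
Proof. by move=> cc'; apply/ffunP => u; rewrite -!ext_val cc'. Qed.

Lemma ext_eq_supported A i (c : chain rk A i) (f : T -> int) :
  supported rk A i f -> (forall u : cells rk A i, c u = f (val u)) ->
  ext c =1 f.
Proof.
by move=> fs cf x; rewrite -(restrK fs); congr (ext _ x); apply/ffunP => u;
   rewrite ffunE.
Qed.

Lemma extB A i (c c' : chain rk A i) x : ext (c - c') x = ext c x - ext c' x.
Proof. by rewrite /ext; case: insub => [u|]; rewrite ?ffunE ?subrr. Qed.

(** A closed subcomplex is stable under the ambient boundary operator. *)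
Lemma ext_bd A i j (c : chain rk A i) :
  (forall x y, y \in faces rk x -> x \in A -> y \in A) -> i = j + 1 ->
  ext (bd om j c) =1 bnd (inc rk om) (ext c).
Proof.
move=> A_closed ij; apply: ext_eq_supported => [x|u]; last exact: bd_val.
case/bnd_neq0 => x' [/ext_supported[x'A x'i] xx'].
split; first exact: A_closed (inc_neq0 xx') x'A.
by move: x'i; rewrite ij (inc_rk xx') -addn1 PoszD => /addIr.
Qed.

Lemma ext_cobd i j (c : chain rk [set: T] i) : j = i + 1 ->
  ext (cobd om j c) =1 bnd (fun x y => inc rk om y x) (ext c).
Proof.
move=> ij; apply: ext_eq_supported => [x|u]; last exact: cobd_val.
case/bnd_neq0 => x' [/ext_supported[_ x'i] xx'].
by rewrite inE (inc_rk xx') ij -x'i -addn1 PoszD.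
Qed.

End Extension.

Section CellResolution.
Context {d : Order.disp_t} {T : finPOrderType d}.
Variables (rk : T -> nat) (om : T -> {set T} -> int).
Hypothesis thinT : thin_complex rk.
Hypothesis conT : forall x : T, flag_connected rk (cl x).
Hypothesis omP : orientation_choice rk om.
Implicit Types (x y z : T) (i j : int).

Lemma cell_based_complex : based_complex rk (inc rk om).
Proof.
split; first exact: inc_rk.
- exact: inc_sqr0.
- exact: inc_edge.
Qed.

Lemma cl_closed y x x' : x' \in faces rk x -> x \in cl y -> x' \in cl y.
Proof. by rewrite !inE => /andP[/ltW x'x _]; apply: le_trans. Qed.

Lemma chain_sum_bd y (c : chain rk (cl y) (0 + 1)) : chain_sum (bd om 0 c) = 0.
Proof.
rewrite chain_sum_ext (eq_bigr _ (fun x _ =>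
  @ext_bd _ _ rk om _ _ _ c (@cl_closed y) (erefl _) x)).
rewrite exchange_big big1 // => x _; rewrite -mulr_sumr.
have [->|/ext_supported[_ [x1]]] := eqVneq (ext c x) 0; first by rewrite mul0r.
by rewrite inc_edge ?mulr0.
Qed.

(** An abstract isomorphism of [H_0] with the integers forces the augmentation
    to be injective on [H_0].  If [g] represents the class sent to 1, then every
    class is an integer multiple of that of [g], so every augmentation is the
    same multiple of that of [g]; a vertex has augmentation 1, so that of [g]
    is not zero. *)
Lemma hclass_degree0 y (z : cycles (@bd _ _ rk om (cl y) 0 (0 - 1))) :
  zmod_iso (hlgy rk om (cl y) 0) int -> chain_sum (val z) = 0 ->
  hclass (@bd _ _ rk om (cl y) (0 + 1) 0) z = 0.
Proof.
pose cls : {additive cycles (@bd _ _ rk om (cl y) 0 (0 - 1)) ->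
  hlgy rk om (cl y) 0} := @hclass _ _ _ (@bd _ _ rk om (cl y) (0 + 1) 0) _.
rewrite -[hclass _ z]/(cls z); case=> phi [psi phiK psiK] z0.
have [g eg] : exists g, cls g = psi 1 := hclass_surj (psi 1).
have classE t : cls t = cls g *~ phi (cls t).
  by apply: (can_inj phiK); rewrite raddfMz /= eg psiK intz.
have sumE t : chain_sum (val t) = chain_sum (val g) * phi (cls t).
  have : cls (t - g *~ phi (cls t)) = 0.
    by rewrite raddfB raddfMz /= -classE subrr.
  case/hclass_eq0 => u /(congr1 (@chain_sum _ _ _ _ _)).
  rewrite chain_sum_bd !raddfB !raddfMz /= => /esym/eqP.
  by rewrite ?mulNrz subr_eq0 => /eqP ->; rewrite mulrzz.
have [v vy v0] := vertex_below thinT y.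
pose cv : chain rk (cl y) 0 := restr rk (cl y) 0 (fun x => (x == v)%:R).
have cvK : ext cv =1 (fun x => (x == v)%:R).
  by apply: restrK => x; have [-> _|_] := eqVneq x v; rewrite ?eqxx // inE vy v0.
have [|t et] := @cycle_of _ _ (bd om (0 - 1) : {additive chain rk (cl y) 0 -> _}) cv.
  by apply/ffunP => u; exfalso; case/andP: (valP u).
have sum_cv : chain_sum cv = 1.
  rewrite chain_sum_ext (eq_bigr _ (fun x _ => cvK x)) (bigD1 v) //= eqxx.
  by rewrite big1 ?addr0 // => x /negbTE ->.
have := sumE t; rewrite et sum_cv => sum_g.
have /eqP := sumE z; rewrite z0 eq_sym mulf_eq0 => /orP[/eqP g0|/eqP phi0].
  by move/eqP: sum_g; rewrite g0 mul0r oner_eq0.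
by rewrite classE phi0 mulr0z.
Qed.

Lemma cell_acyclic_fibres : (forall x, acyclic rk om (cl x)) ->
  acyclic_fibres rk (inc rk om) (fun x y => (x <= y)%O).
Proof.
move=> acyc; split.
- move=> x x' y /inc_neq0; rewrite inE => /andP[/ltW x'x _].
  exact: le_trans.
- exact: vertex_below.
move=> y p c c_supp c_cycle c_aug.
have csup : supported rk (cl y) p c by move=> x /c_supp[xy xp]; rewrite inE.
have cK := restrK csup.
have bd0 : bd om (p - 1) (restr rk (cl y) p c) = 0.
  apply/ext_eq0 => x; rewrite (@ext_bd _ _ _ _ _ _ _ _ (@cl_closed y)) ?subrK //.
  by rewrite (eq_bnd _ cK).
have [z ez] := cycle_of bd0.
have : hclass (@bd _ _ rk om (cl y) (p + 1) p) z = 0.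
  have [p0|p0|p0] := ltgtP p 0.
  - apply/hclass_eq0; exists 0; rewrite raddf0; apply/ffunP => u; exfalso.
    by move: p0; case/andP: (valP u) => _ /eqP <-.
  - exact: (acyc y).1.
  - subst p; apply: hclass_degree0; first exact: (acyc y).2.
    by rewrite ez chain_sum_ext (eq_bigr _ (fun x _ => cK x)) c_aug.
case/hclass_eq0 => u; rewrite ez => bdu; exists (ext u).
  by move=> x /ext_supported; rewrite inE.
move=> x; rewrite -(@ext_bd _ _ _ om (cl y) (p + 1) p) ?bdu ?cK //.
exact: cl_closed.
Qed.

End CellResolution.

(** * Duality *)

Theorem theorem9p2 (d : Order.disp_t) (T : finPOrderType d) (rk : T -> nat)
  (n : nat)
  (Sccc : is_ccc rk)
  (Sdim : ccdim rk [set: T] = n)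
  (Sman : manifold_like rk [set: T])
  (Sori : orientable rk [set: T])
  (Sconn : forall x : T, flag_connected rk (cl x))
  (Dconn : forall x : T^d, flag_connected (dual_rk n rk) (cl x))
  (om : T -> {set T} -> int)
  (om_ori : orientation_choice rk om)
  (om' : T^d -> {set T^d} -> int)
  (om'_ori : orientation_choice (dual_rk n rk) om')
  (Sacyc : forall x : T, acyclic rk om (cl x))
  (Dacyc : forall x : T^d, acyclic (dual_rk n rk) om' (cl x))
  (i : int) :
  zmod_iso (hlgy rk om [set: T] i) (cohlgy rk om [set: T] (n%:Z - i)).
Proof.
have thinT := ccc_thin Sccc Sman.
have thinD := dual_thin Sccc Sdim Sman.
pose s := inc rk om; pose t := inc (dual_rk n rk) om'.
pose R (x : T) (y : T^d) : bool := (x <= (y : T))%O.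
have sC : based_complex rk s := cell_based_complex thinT Sconn om_ori.
have tC : based_complex (dual_rk n rk) t := cell_based_complex thinD Dconn om'_ori.
have sF : acyclic_fibres rk s R := cell_acyclic_fibres thinT Sconn om_ori Sacyc.
have tF : acyclic_fibres (dual_rk n rk) t (fun y x => R x y) :=
  cell_acyclic_fibres thinD Dconn om'_ori Dacyc.
have [eps [eps_sqr tE]] :=
  dual_sign thinT thinD Sdim Sconn Dconn Sori.2 om_ori om'_ori.
have epsK x (k : int) : eps x * (eps x * k) = k by rewrite mulrA eps_sqr mul1r.
have eps_neq0 x (k : int) : eps x * k != 0 -> k != 0.
  by rewrite mulf_eq0 negb_or => /andP[].
have dual_deg x (j : int) : (dual_rk n rk x)%:Z = j <-> (rk x)%:Z = n%:Z - j.
  by have := rk_dim Sdim x; rewrite /dual_rk; split; lia.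
(* Rescaling by eps carries cochains of the complex to chains of its dual. *)
pose tw (f : T -> int) (y : T^d) := eps y * f y.
have bnd_tw f y : bnd t (tw f) y = eps y * bnd (fun x y => s y x) f y.
  rewrite /bnd mulr_sumr; apply: eq_bigr => x _; rewrite /t tE /tw.
  by rewrite -[in RHS](epsK x (f x)) /s; ring.
have closedT x y : y \in faces rk x -> x \in [set: T] -> y \in [set: T].
  by rewrite inE.
pose L := linked rk (dual_rk n rk) s t R i.
apply: (@homology_iso _ _ _ _ _ _ _ _ _ _
         (fun v1 v2 => L (ext v1) (tw (ext v2)))).
- move=> u1 u2 v1 v2 Lu Lv; apply: eq_linked (linkedB Lu Lv) _ _ => [x|y].
    by rewrite extB.
  by rewrite /tw extB mulrBr.
- move=> v1 gv1.
  have [||g Lg] := @linked_right _ _ _ _ _ _ _ sC tC sF tF i (ext v1).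
  + by move=> x /ext_supported[].
  + move=> x; rewrite -(@ext_bd _ _ rk om _ _ _ v1 closedT (_ : i = i - 1 + 1)).
      by rewrite gv1 (ext_eq0 _).1.
    by rewrite subrK.
  have [_ _ g_supp tg0] := linked_cycle sC tC Lg.
  pose v2 := restr rk [set: T] (n%:Z - i) (tw g).
  have v2E : ext v2 =1 tw g.
    by apply: restrK => x /eps_neq0/g_supp/dual_deg; rewrite inE.
  have tw_v2 : tw (ext v2) =1 g by move=> y; rewrite /tw v2E /tw epsK.
  exists v2; last by apply: eq_linked Lg _ _ => // y; rewrite tw_v2.
  apply/ext_eq0 => y; rewrite ext_cobd //; apply: (can_inj (epsK y)).
  by rewrite -bnd_tw (eq_bnd _ tw_v2) tg0 mulr0.
- move=> v2 gv2.
  have [||f Lf] := @linked_left _ _ _ _ _ _ _ sC tC sF tF i (tw (ext v2)).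
  + by move=> y /eps_neq0/ext_supported[_] /dual_deg.
  + move=> y; rewrite bnd_tw -(@ext_cobd _ _ rk om _ (n%:Z - i + 1) v2) //.
    by rewrite gv2 (ext_eq0 _).1 // mulr0.
  have [f_supp sf0 _ _] := linked_cycle sC tC Lf.
  pose v1 := restr rk [set: T] i f.
  have v1E : ext v1 =1 f by apply: restrK => x /f_supp; rewrite inE.
  exists v1; last by apply: eq_linked Lf _ _ => // x; rewrite v1E.
  apply/ext_eq0 => x; rewrite (@ext_bd _ _ rk om _ _ _ v1 closedT) ?subrK //.
  by rewrite (eq_bnd _ v1E) sf0.
move=> v1 v2 /(linked_boundary sC tC sF tF)[Lr Ll]; split=> [[u uv1]|[u uv2]].
  have [|c c_supp tc] := Lr.
    exists (ext u); first by move=> x /ext_supported[].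
    by move=> x; rewrite -(@ext_bd _ _ rk om _ _ i u closedT) ?uv1.
  pose e := restr rk [set: T] (n%:Z - i - 1) (tw c).
  have eE : ext e =1 tw c.
    apply: restrK => x /eps_neq0/c_supp/dual_deg; rewrite inE => ->.
    by rewrite opprD addrA.
  exists e; apply: ext_eq => y; rewrite ext_cobd ?subrK //.
  apply: (can_inj (epsK y)); rewrite -bnd_tw -[RHS]tc.
  by apply: eq_bnd => x; rewrite /tw eE /tw epsK.
have [|c c_supp sc] := Ll.
  exists (tw (ext u)).
    move=> y /eps_neq0/ext_supported[_ e]; apply/dual_deg.
    by rewrite e opprD addrA.
  by move=> y; rewrite bnd_tw -(@ext_cobd _ _ rk om _ (n%:Z - i) u) ?subrK // uv2.
pose e := restr rk [set: T] (i + 1) c.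
have eE : ext e =1 c by apply: restrK => x /c_supp; rewrite inE.
exists e; apply: ext_eq => x; rewrite (@ext_bd _ _ rk om _ _ _ e closedT) //.
by rewrite (eq_bnd _ eE) sc.
Qed.
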